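(* For every integer $n\ge 0$ let \[ W_n=\sum_{k=0}^{\lfloor n/2\rfloor}\binom{n}{2k}\frac{\binom{2k}{k}}{2k-1}. \] Then: (i) For every positive integer $n$, \[ \sum_{k=0}^{n-1}(8k+9)W_k^2\equiv n \pmod{2n}. \] (ii) For every odd prime $p$, \[ \frac{1}{p}\sum_{k=0}^{p-1}(8k+9)W_k^2\equiv 24+10\left(\frac{-1}{p}\right)-9\left(\frac{p}{3}\right)-18\left(\frac{3}{p}\right)\pmod{p}. \]
   Context: Each $W_n$ is an integer. $\left(\frac{\cdot}{\cdot}\right)$ denotes the Legendre symbol (with $\left(\frac{p}{3}\right)=0$ when $p=3$ and $\left(\frac{3}{p}\right)=0$ when $p=3$). *)

(* Defs.v *)
From mathcomp Require Import all_boot all_order all_algebra.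

Set Implicit Arguments.
Unset Strict Implicit.
Unset Printing Implicit Defensive.

Import Order.TTheory GRing.Theory Num.Theory.
Local Open Scope ring_scope.

(* The division takes place in rat; the denominator 2k - 1 is the rational -1
   when k = 0. *)
Definition W (n : nat) : rat :=
  \sum_(k < n./2.+1)
    'C(n, 2 * k)%:R * ('C(2 * k, k)%:R / (2%:R * k%:R - 1)).

(* Congruence of integers that are presented as rationals: the quotient of
   x - y by m is an integer (not merely m-integral). *)
Definition eqmod_rat (m : nat) (x y : rat) : Prop :=
  exists z : int, x - y = m%:R * z%:~R.

Definition legendre (a : int) (p : nat) : int :=
  if (p%:Z %| a)%Z then 0
  else if [exists x : 'I_p, ((x%:Z ^+ 2)%R == a %[mod p%:Z])%Z] then 1
  else -1.

(* Main.v *)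
Require Import Defs.
From mathcomp Require Import all_boot all_order all_algebra.
From mathcomp Require Import all_fingroup all_solvable all_field.
From mathcomp Require Import ring zify.

Import Order.TTheory GRing.Theory Num.Theory.
Local Open Scope ring_scope.

(** Let T_n and s_n be the coefficients of x^0 and x^1 in (x + 1 + 1/x)^n and
    let U_n = T_0 + ... + T_(n-1). Termwise binomial identities give a first
    order recurrence for (T, s, U) and
    W_n = - T_n - 2 (n + 1) s_n + 4 n U_n.
    Hence 2 * sum_(k < n) (8k + 9) W_k^2 telescopes to n * Q_n, where Q_n is a
    quadratic form in (T_n, T_(n-1), U_n) whose coefficients are polynomials
    in n. Since every T_n is odd, Q_n = 2 mod 4, which is (i). For n = p one has
    T_p = 1, T_(p-1) = (-3)^((p-1)/2) and U_p = (-1)^((p-1)/2) modulo p, and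
    (ii) follows from Euler's criterion and (-3/p) = (p/3), the latter because
    -3 is a square mod p iff p = 1 mod 3 (existence of cube roots of unity). *)

(** * Binomial sums and the telescoped sum of squares *)

Lemma sum_ord_widen {R : nmodType} (F : nat -> R) m n :
  (m <= n)%N -> (forall k, (m <= k)%N -> F k = 0) ->
  \sum_(k < m) F k = \sum_(k < n) F k.
Proof.
move=> le_mn F0.
rewrite (big_ord_widen _ F le_mn) [RHS](bigID (fun k : 'I_n => (k < m)%N)) /=.
by rewrite [X in _ + X]big1 ?addr0 // => k; rewrite -leqNgt; exact: F0.
Qed.

Lemma bin_half_odd k : 'C((2 * k).+1, k.+1) = 'C((2 * k).+1, k).
Proof.
have le_k : (k <= (2 * k).+1)%N by lia.
by rewrite -[RHS](bin_sub le_k) (_ : (2 * k).+1 - k = k.+1)%N //; lia.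
Qed.

Lemma central_bin_double k : 'C((2 * k).+2, k.+1) = (2 * 'C((2 * k).+1, k))%N.
Proof. by rewrite binS bin_half_odd [RHS]mul2n -addnn. Qed.

Lemma mul_central_bin k :
  ((2 * k).+1 * 'C(2 * k, k) = k.+1 * 'C((2 * k).+1, k))%N.
Proof. by rewrite -bin_half_odd -mul_bin_diag. Qed.

(* [ctri n] and [stri n] are the coefficients of x^0 and x^1 in
   (x + 1 + x^-1)^n, and [utri n] is the sum of [ctri j] over j < n. *)
Definition ctri (n : nat) : nat :=
  (\sum_(k < n./2.+1) 'C(n, 2 * k) * 'C(2 * k, k))%N.

Definition stri (n : nat) : nat :=
  (\sum_(k < n./2.+1) 'C(n, (2 * k).+1) * 'C((2 * k).+1, k))%N.

Definition utri (n : nat) : nat :=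
  (\sum_(k < n./2.+1) 'C(n, (2 * k).+1) * 'C(2 * k, k))%N.

(** Terms beyond [n./2] vanish, so sums for [n] and [n.+1] can be compared over one common range. *)
Lemma ctriE N n : (n./2 < N)%N ->
  ctri n = (\sum_(k < N) 'C(n, 2 * k) * 'C(2 * k, k))%N.
Proof.
move=> ltnN.
apply: (@sum_ord_widen nat
  (fun k => 'C(n, 2 * k) * 'C(2 * k, k))%N) => // k ltnk.
by rewrite bin_small ?mul0n //; lia.
Qed.

Lemma striE N n : (n./2 < N)%N ->
  stri n = (\sum_(k < N) 'C(n, (2 * k).+1) * 'C((2 * k).+1, k))%N.
Proof.
move=> ltnN.
apply: (@sum_ord_widen nat
  (fun k => 'C(n, (2 * k).+1) * 'C((2 * k).+1, k))%N) => // k ltnk.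
by rewrite bin_small ?mul0n //; lia.
Qed.

Lemma utriE N n : (n./2 < N)%N ->
  utri n = (\sum_(k < N) 'C(n, (2 * k).+1) * 'C(2 * k, k))%N.
Proof.
move=> ltnN.
apply: (@sum_ord_widen nat
  (fun k => 'C(n, (2 * k).+1) * 'C(2 * k, k))%N) => // k ltnk.
by rewrite bin_small ?mul0n //; lia.
Qed.

Lemma ctriS n : ctri n.+1 = (ctri n + 2 * stri n)%N.
Proof.
rewrite (@ctriE n.+2 n.+1) ?(@ctriE n.+2 n) ?(@striE n.+1 n); try lia.
rewrite big_ord_recl [in X in _ = (X + _)%N]big_ord_recl /= !muln0 !bin0 -addnA.
congr addn; rewrite big_distrr -big_split /=; apply: eq_bigr => k _.
rewrite /bump /= add1n mulnS add2n binS mulnDl central_bin_double.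
by congr addn; rewrite mulnCA.
Qed.

Lemma utriS n : utri n.+1 = (utri n + ctri n)%N.
Proof.
rewrite (@utriE n.+2 n.+1) ?(@utriE n.+2 n) ?(@ctriE n.+2 n); try lia.
by rewrite -big_split /=; apply: eq_bigr => k _; rewrite binS mulnDl.
Qed.

(** Multiplied by n+1, the terms 2 C(n,2k) C(2k,k) and C(n,2k+1) C(2k+1,k) become 2(k+1) and n-2k
    times C(n+1,2k+1) C(2k+1,k); the two factors add up to n+2. *)
Lemma striS n : (n.+2 * stri n.+1 = n.+1 * (2 * ctri n + stri n))%N.
Proof.
rewrite (@striE n.+2 n.+1) ?(@striE n.+2 n) ?(@ctriE n.+2 n); try lia.
rewrite mulnDr !big_distrr -big_split /=; apply: eq_bigr => -[k /= _] _.
have Et : (n.+1 * ('C(n, 2 * k) * 'C(2 * k, k)) =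
           k.+1 * ('C(n.+1, (2 * k).+1) * 'C((2 * k).+1, k)))%N.
  rewrite mulnA (mul_bin_diag n.+1) -mulnA (mulnCA _ 'C(_, _)) mulnA.
  by rewrite [RHS]mulnCA -mul_central_bin; ring.
have Eu : (n.+1 * ('C(n, (2 * k).+1) * 'C((2 * k).+1, k)) =
   (n.+1 - (2 * k).+1) * ('C(n.+1, (2 * k).+1) * 'C((2 * k).+1, k)))%N.
  by rewrite mulnA (mul_bin_down n.+1) -mulnA.
rewrite [X in _ = (X + _)%N]mulnCA Et Eu.
case: (leqP (2 * k).+1 n.+1) => [le_k | lt_k].
  rewrite (_ : n.+2 = 2 * k.+1 + (n.+1 - (2 * k).+1))%N; last lia.
  by rewrite mulnDl -!mulnA.
by rewrite (bin_small lt_k) !mul0n !muln0.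
Qed.

(* Termwise, 2k C(2k,k) / (2k-1) = 4 C(2k-2,k-1). *)
Lemma W_shift n :
  W n = - (ctri n)%:R
        + 4 * \sum_(k < n./2.+1) ('C(n, (2 * k).+2) * 'C(2 * k, k))%:R.
Proof.
pose F k : rat := 'C(n, 2 * k)%:R * ('C(2 * k, k)%:R / (2 * k%:R - 1)).
(* A vanishing term is appended so that [n./2.+1] terms remain once k = 0 is split off; the k = 0
   term of W is -1, that of [ctri] is 1. *)
rewrite /W (@sum_ord_widen _ F _ n./2.+2) //; last first.
  by move=> k lt_k; rewrite /F bin_small ?mul0r //; lia.
rewrite (@ctriE n./2.+2) // natr_sum /F big_ord_recl.
rewrite [in X in _ = - X + _]big_ord_recl /= !muln0 !bin0 opprD -addrA.
congr (_ + _); rewrite -sumrN mulr_sumr -big_split /=; apply: eq_bigr => k _.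
rewrite /bump /= add1n mulnS add2n natrM natrM.
have /(congr1 (fun x => x%:R : rat)) := mul_central_bin k.
rewrite central_bin_double !natrM => E.
have k1 : (k.+1%:R : rat) != 0 by rewrite pnatr_eq0.
have k2 : (2 * k)%N.+1%:R != 0 :> rat by rewrite pnatr_eq0.
have -> : 'C((2 * k).+1, k)%:R =
    (2 * k)%N.+1%:R * 'C(2 * k, k)%:R / k.+1%:R :> rat.
  by rewrite E mulrC mulKf.
move: k1 k2; rewrite -(natr1 k) -(natr1 (2 * k)) natrM => k1 k2; field.
by rewrite k1 /=; apply: contraNneq k2 => <-; apply/eqP; ring.
Qed.

Lemma W_ctri n :
  W n = - (ctri n)%:R - 2 * n.+1%:R * (stri n)%:R + 4 * n%:R * (utri n)%:R.
Proof.
rewrite W_shift /stri /utri !natr_sum -addrA; congr (_ + _).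
rewrite !mulr_sumr -sumrN -big_split /=; apply: eq_bigr => k _.
have /(congr1 (fun x => x%:R : rat)) := mul_central_bin k.
have /(congr1 (fun x => x%:R : rat)) := mul_bin_diag n.+1 (2 * k).+1.
rewrite /= binS !(natrM, natrD) -!natr1 natrM.
set a := 'C(n, (2 * k).+1)%:R; set b := 'C(n, (2 * k).+2)%:R.
set c := 'C(_, _)%:R; set d := 'C(_, _)%:R => E1 E2.
apply/eqP; rewrite -subr_eq0; apply/eqP.
(* The difference of the two sides is a combination of the relations [E1] and [E2]. *)
transitivity ((2 * d - 4 * c) * ((n%:R + 1) * a - (2 * k%:R + 1 + 1) * (b + a))
  - 4 * (a + b) * ((2 * k%:R + 1) * c - (k%:R + 1) * d)); first by ring.
by rewrite E1 E2 !subrr; ring.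
Qed.

(* The coefficients solve the linear system given by the first values of the
   sum, see [sum_W_sqr]. *)
Definition qform {R : comPzRingType} (n t t' u : R) : R :=
  n * (4 * n ^+ 2 + 6 * n + 5) * t ^+ 2
  + (24 * n ^+ 3 + 12 * n ^+ 2 - 6 * n - 18) * t * t'
  + (20 + 16 * n - 16 * n ^+ 2 - 32 * n ^+ 3) * t * u
  + n * (36 * n ^+ 2 - 18 * n - 27) * t' ^+ 2
  + (96 * n + 48 * n ^+ 2 - 96 * n ^+ 3 - 36) * t' * u
  + (64 * n ^+ 3 - 32 * n ^+ 2 - 80 * n + 48) * u ^+ 2.

Lemma sum_W_sqr n :
  2 * (\sum_(k < n.+1) (8 * k%:R + 9) * W k ^+ 2) =
  n.+1%:R * qform n.+1%:R (ctri n.+1)%:R (ctri n)%:R (utri n.+1)%:R.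
Proof.
elim: n => [|n IHn].
  rewrite big_ord_recl big_ord0 W_ctri /ctri /stri /utri /qform.
  by rewrite !big_ord_recl !big_ord0 /=; apply/eqP; vm_compute.
rewrite big_ord_recr mulrDr {}IHn /= W_ctri.
(* Everything is now expressed through [ctri n], [stri n] and [utri n]. The recurrence for [stri] is
   used twice, since expanding [ctri n.+2] brings [stri n.+1] back. *)
have n2 : n.+2%:R != 0 :> rat by rewrite pnatr_eq0.
have /(congr1 (fun x => x%:R : rat)) := striS n.
rewrite natrM => /(canRL (mulKf n2)) ->.
rewrite (ctriS n.+1) !natrD natrM.
have /(congr1 (fun x => x%:R : rat)) := striS n.
rewrite natrM => /(canRL (mulKf n2)) ->.
rewrite (utriS n.+1) (utriS n) (ctriS n) !(natrM, natrD).
move: n2; rewrite -!natr1 /qform => n2; field.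
by apply: contraNneq n2 => <-; apply/eqP; ring.
Qed.

(** * Parity, for claim (i) *)

Lemma odd_ctri n : odd (ctri n).
Proof.
elim: n => [|n IHn]; last by rewrite ctriS oddD IHn oddM.
by rewrite /ctri big_ord_recl big_ord0.
Qed.

Lemma rmorph_qform {R S : comPzRingType} (f : {rmorphism R -> S})
    (n t t' u : R) :
  f (qform n t t' u) = qform (f n) (f t) (f t') (f u).
Proof.
by rewrite /qform; ring.
Qed.

Lemma qform_mod4 (n t t' u : int) : (t %% 2 = 1)%Z -> (t' %% 2 = 1)%Z ->
  exists z, qform n t t' u = 2 + 4 * z.
Proof.
move=> t1 t'1; set a := (t %/ 2)%Z; set b := (t' %/ 2)%Z.
rewrite (divz_eq t 2) t1 -/a (divz_eq t' 2) t'1 -/b /qform.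
(* Quotient by 4 of the form expanded at t = 2a+1, t' = 2b+1; its value at t = t' = 1, u = 0 is
   64n^3 - 28n - 18. *)
exists (n * (4 * n ^+ 2 + 6 * n + 5) * (a ^+ 2 + a)
  + n * (36 * n ^+ 2 - 18 * n - 27) * (b ^+ 2 + b)
  + (24 * n ^+ 3 + 12 * n ^+ 2 - 6 * n - 18) * a * b
  + (12 * n ^+ 3 + 6 * n ^+ 2 - 3 * n - 9) * (a + b)
  + (16 * n ^+ 3 - 7 * n - 5)
  + (5 + 4 * n - 4 * n ^+ 2 - 8 * n ^+ 3) * (a * 2 + 1) * u
  + (24 * n + 12 * n ^+ 2 - 24 * n ^+ 3 - 9) * (b * 2 + 1) * u
  + (16 * n ^+ 3 - 8 * n ^+ 2 - 20 * n + 12) * u ^+ 2).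
by ring.
Qed.

Lemma sum_W_sqr_odd n :
  exists z : int, \sum_(k < n.+1) (8 * k%:R + 9) * W k ^+ 2 =
    n.+1%:R * (1 + 2 * z)%:~R :> rat.
Proof.
have odd1 m : ((ctri m)%:Z %% 2 = 1)%Z by have := odd_ctri m; lia.
have [z Ez] := @qform_mod4 n.+1%:Z _ _ (utri n.+1)%:Z (odd1 n.+1) (odd1 n).
exists z; have /(congr1 (fun x => x / 2)) := sum_W_sqr n.
rewrite [2 * _]mulrC mulfK // => ->.
have := congr1 (intr : int -> rat) Ez; rewrite (rmorph_qform intr) => ->.
by field.
Qed.

(** * Euler's criterion and the quadratic character of -3 *)

Section EulerCriterion.
Variables (F : finFieldType) (h : nat) (cardF : #|F| = h.*2.+1).

Lemma expf_card_half (x : F) : x != 0 -> x ^+ h.*2 = 1.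
Proof.
by move=> nz_x; apply: (mulfI nz_x); rewrite mulr1 -exprS -cardF expf_card.
Qed.

Lemma expf_half_cases (x : F) : x != 0 -> x ^+ h = 1 \/ x ^+ h = -1.
Proof.
move=> /expf_card_half; rewrite -muln2 exprM => /eqP.
by rewrite sqrf_eq1 => /orP[]/eqP; auto.
Qed.

(** The unit group is cyclic of order 2h. If x = g^k for a generator g, then x^h = 1 forces 2h to
    divide kh, so k is even. *)
Lemma sqrf_of_expf_half (x : F) : x ^+ h = 1 -> exists y, x = y ^+ 2.
Proof.
move=> xh1.
have h_gt0 : (0 < h)%N by have := finNzRing_gt1 F; rewrite cardF; lia.
have Ux : x \is a GRing.unit.
  rewrite unitfE; apply: contra_eqN xh1 => /eqP ->.
  by rewrite expr0n eqn0Ngt h_gt0 /= eq_sym oner_neq0.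
have /cyclicP[g Dg] := field_unit_group_cyclic [set: {unit F}]%G.
have /cycleP[k Dk] : FinRing.unit F Ux \in <[g]>%g by rewrite -Dg inE.
have og : #[g]%g = (2 * h)%N.
  by rewrite orderE -Dg card_finField_unit cardF mul2n.
have : (#[g]%g %| k * h)%N.
  rewrite order_dvdn expgM -Dk; apply/eqP/val_inj.
  by rewrite FinRing.val_unitX.
rewrite og dvdn_pmul2r // => /dvdnP[j Dj].
by exists (val g ^+ j); rewrite -exprM -Dj -FinRing.val_unitX -Dk.
Qed.
End EulerCriterion.

Lemma intr_Fp_eq0 (p : nat) (a : int) : prime p ->
  (a%:~R == 0 :> 'F_p) = (p%:Z %| a)%Z.
Proof. by move=> p_pr; rewrite (dvdz_pcharf (pchar_Fp p_pr)). Qed.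

Lemma legendre_Fp p (a : int) : prime p -> odd p ->
  (legendre a p)%:~R = a%:~R ^+ p./2 :> 'F_p.
Proof.
move=> p_pr p_odd; have p_gt1 := prime_gt1 p_pr.
have cardF : #|'F_p| = (p./2).*2.+1 by rewrite card_Fp //; lia.
rewrite /legendre -intr_Fp_eq0 //; case: eqVneq => [-> | nz_a].
  by rewrite expr0n; case: eqP => //; lia.
case: existsP => [[x] | no_x].
  rewrite eqz_mod_dvd -intr_Fp_eq0 // rmorphB rmorphXn subr_eq0 => /eqP Ea.
  rewrite -Ea -exprM mul2n (expf_card_half _ _ cardF) //.
  by apply: contraNneq nz_a => x0; rewrite -Ea x0 expr0n.
have [Ea | ->] := expf_half_cases _ _ cardF _ nz_a; last by rewrite rmorphN1.
have [y Ey] := sqrf_of_expf_half _ _ cardF _ Ea.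
(* The root y, an element of ['F_p], is itself the required residue below p. *)
case: no_x; have lt_y : (y < p)%N by rewrite -[p in (_ < p)%N](Fp_cast p_pr).
exists (Ordinal lt_y); rewrite eqz_mod_dvd -intr_Fp_eq0 // rmorphB rmorphXn.
by rewrite /= Ey -pmulrn natr_Zp subrr.
Qed.

(** Since (2w+1)^2 + 3 = 4(w^2+w+1), square roots of -3 correspond to primitive cube roots of unity
    when p > 3. For p = 3 both sides are 0. *)
Lemma expN3_half p : prime p -> odd p ->
  (-3) ^+ p./2 = (legendre p%:Z 3)%:~R :> 'F_p.
Proof.
move=> p_pr p_odd; have p_gt1 := prime_gt1 p_pr.
have cardF : #|'F_p| = (p./2).*2.+1 by rewrite card_Fp //; lia.
have nat0 m : (m%:R == 0 :> 'F_p) = (p %| m)%N.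
  by rewrite (dvdn_pcharf (pchar_Fp p_pr)).
have [p3 | p'3] := eqVneq p 3%N.
  rewrite p3 /legendre dvdzz /=; apply/eqP; rewrite expf_eq0 /= oppr_eq0.
  by rewrite -p3 nat0 p3.
have nz2 : 2 != 0 :> 'F_p by rewrite nat0 dvdn_prime2 //; lia.
have nz3 : 3 != 0 :> 'F_p by rewrite nat0 dvdn_prime2.
have p_mod3 : (p %% 3 != 0)%N by rewrite -/(3 %| p)%N dvdn_prime2 // eq_sym.
have lfalse : (3%:Z %| p%:Z)%Z = false by lia.
rewrite /legendre lfalse; case: existsP => [[x] | no_x].
  rewrite eqz_mod_dvd => dvd3.
  have p1 : (p %% 3 = 1)%N by case: x dvd3 => [[|[|[|//]]]] /= _; lia.
  have dvd3p : (3 %| #|[set: {unit 'F_p}]|)%N.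
    by rewrite card_finField_unit cardF; lia.
  (* As 3 divides p-1, Cauchy's theorem gives a unit of order 3. *)
  have [w _ ow] := Cauchy (isT : prime 3) dvd3p.
  have w3 : (val w) ^+ 3 = 1 by rewrite -FinRing.val_unitX -ow expg_order.
  have w1 : val w != 1.
    apply: contra_eqN ow => /eqP w1; rewrite (_ : w = 1%g) ?order1 //.
    exact: val_inj.
  have Ew : (val w) ^+ 2 + val w + 1 = 0.
    apply: (mulfI (_ : val w - 1 != 0)); first by rewrite subr_eq0.
    by transitivity (val w ^+ 3 - 1); [ring | rewrite w3 subrr mulr0].
  have E3 : (2 * val w + 1) ^+ 2 = -3 :> 'F_p.
    by apply/eqP; rewrite -subr_eq0; apply/eqP;
       transitivity (4 * (val w ^+ 2 + val w + 1)); [ring | rewrite Ew mulr0].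
  rewrite -E3.
  rewrite -exprM mul2n (expf_card_half _ _ cardF) //.
  by rewrite -sqrf_eq0 E3 oppr_eq0.
have p2 : (p %% 3 = 2)%N.
  have [p1|] := eqVneq (p %% 3)%N 1%N; last lia.
  by case: no_x; exists (Ordinal (isT : 1 < 3)%N); rewrite eqz_mod_dvd /=; lia.
have nzN3 : -3 != 0 :> 'F_p by rewrite oppr_eq0.
have [EN3 | ->] := expf_half_cases _ _ cardF _ nzN3; last by rewrite rmorphN1.
have [y Ey] := sqrf_of_expf_half _ _ cardF _ EN3.
pose w := (y - 1) / 2.
have Ew : w ^+ 2 + w + 1 = 0.
  transitivity ((y ^+ 2 + 3) / 4); last by rewrite -Ey addrC subrr mul0r.
  by rewrite /w; field; rewrite nz2 (natrM _ 2 2) mulf_neq0.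
have w3 : w ^+ 3 = 1.
  apply/eqP; rewrite -subr_eq0; apply/eqP.
  by transitivity ((w - 1) * (w ^+ 2 + w + 1)); [ring | rewrite Ew mulr0].
have nz_w : w != 0.
  by apply: contra_eqN w3 => /eqP ->; rewrite expr0n eq_sym oner_neq0.
(* Here p-1 is 1 mod 3, so w^(p-1) = 1 and w^3 = 1 give w = 1; then 3 = w^2+w+1 = 0, a
   contradiction. *)
have w1 : w = 1.
  have := expf_card_half _ _ cardF _ nz_w.
  rewrite (_ : p./2.*2 = 3 * (p %/ 3) + 1)%N; last lia.
  by rewrite exprD exprM w3 expr1n mul1r.
case/eqP: nz3; rewrite -Ew w1; ring.
Qed.

(** * The binomial sums modulo an odd prime *)

Section ModuloPrime.
Variables (p : nat) (p_pr : prime p) (p_odd : odd p).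
Let h := p./2.

Let natFp_eq0 m : (m%:R == 0 :> 'F_p) = (p %| m)%N.
Proof. by rewrite (dvdn_pcharf (pchar_Fp p_pr)). Qed.

Let bin_p_Fp k : (0 < k < p)%N -> 'C(p, k)%:R = 0 :> 'F_p.
Proof. by move=> lt_k; apply/eqP; rewrite natFp_eq0 prime_dvd_bin. Qed.

Lemma bin_pred_Fp k : (k < p)%N -> 'C(p.-1, k)%:R = (-1) ^+ k :> 'F_p.
Proof.
elim: k => [|k IHk] lt_k; first by rewrite bin0.
have Ebin : 'C(p, k.+1) = ('C(p.-1, k.+1) + 'C(p.-1, k))%N.
  by rewrite -binS prednK ?prime_gt0.
have := bin_p_Fp k.+1 lt_k; rewrite Ebin natrD.
by rewrite IHk ?(ltnW lt_k) // exprS mulN1r => /eqP; rewrite addr_eq0 => /eqP.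
Qed.

(** This is C(2k,k) = (-4)^k C(-1/2,k), with h = (p-1)/2 congruent to -1/2 mod p. *)
Lemma central_bin_Fp k : (k <= h)%N ->
  'C(2 * k, k)%:R = (-4) ^+ k * 'C(h, k)%:R :> 'F_p.
Proof.
elim: k => [|k IHk] lt_k; first by rewrite !bin0 mulr1.
have nz_k : k.+1%:R != 0 :> 'F_p.
  by rewrite natFp_eq0 gtnNdvd //; lia.
apply: (mulfI nz_k); rewrite mulnS add2n central_bin_double -!natrM.
rewrite mulnCA -mul_central_bin natrM natrM IHk 1?ltnW //.
rewrite [RHS]mulrCA -natrM mul_bin_left natrM natrB 1?ltnW // exprS.
have Eh : 2 * h%:R + 1 = 0 :> 'F_p.
  rewrite -natrM natr1; apply/eqP.
  by rewrite natFp_eq0 (_ : (2 * h).+1 = p) //; lia.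
rewrite -(natr1 (2 * k)%N) natrM; apply/eqP; rewrite -subr_eq0; apply/eqP.
transitivity (2 * (-4) ^+ k * 'C(h, k)%:R * (2 * h%:R + 1) : 'F_p).
  by ring.
by rewrite Eh mulr0.
Qed.

Lemma ctri_prime : (ctri p)%:R = 1 :> 'F_p.
Proof.
rewrite /ctri natr_sum big_ord_recl big1 ?addr0 ?muln0 ?bin0 // => k _.
rewrite natrM bin_p_Fp ?mul0r //= /bump /=; have := ltn_ord k; lia.
Qed.

(** Modulo p the sum becomes the binomial expansion of (1-4)^h, because C(p-1,2k) is 1. *)
Lemma ctri_pred_prime : (ctri p.-1)%:R = (-3) ^+ h :> 'F_p.
Proof.
rewrite (@ctriE h.+1) /h; last lia.
rewrite (_ : -3 = 1 + -4) ?exprDn ?natr_sum; last by ring.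
apply: eq_bigr => k _; have lt_k := ltn_ord k.
rewrite expr1n mul1r natrM bin_pred_Fp; last lia.
by rewrite exprM sqrrN expr1n expr1n mul1r central_bin_Fp // mulr_natr.
Qed.

(** Only the last term survives, where 2k+1 = p; it equals C(p-1,h). *)
Lemma utri_prime : (utri p)%:R = (-1) ^+ h :> 'F_p.
Proof.
rewrite /utri natr_sum big_ord_recr big1 ?add0r /= => [|k _]; last first.
  by rewrite natrM bin_p_Fp ?mul0r //=; have := ltn_ord k; lia.
have -> : 'C(p, (2 * p./2).+1) = 1%N.
  by rewrite -[RHS](binn p); congr binomial; lia.
have -> : 'C(2 * p./2, p./2) = 'C(p.-1, p./2).
  by have -> : (2 * p./2 = p.-1)%N by lia.
by rewrite mul1n bin_pred_Fp ?add0r //; have := prime_gt0 p_pr; lia.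
Qed.
End ModuloPrime.

Theorem theorem1p1 :
  (forall n : nat, (0 < n)%N ->
     eqmod_rat (2 * n) (\sum_(k < n) (8%:R * k%:R + 9%:R) * W k ^+ 2) n%:R)
  /\
  (forall p : nat, prime p -> odd p ->
     eqmod_rat p
       (p%:R^-1 * \sum_(k < p) (8%:R * k%:R + 9%:R) * W k ^+ 2)
       (24 + 10 * legendre (-1) p - 9 * legendre p%:Z 3
          - 18 * legendre 3 p)%:~R).
Proof.
split=> [[//|n] _ | p p_pr p_odd].
  have [z ->] := sum_W_sqr_odd n; exists z.
  by rewrite natrM; ring.
have p_gt0 := prime_gt0 p_pr; have Ep : p = p.-1.+1 by rewrite prednK.
have nz_p : p%:R != 0 :> rat by rewrite pnatr_eq0 -lt0n.
have [z Ez] := sum_W_sqr_odd p.-1; rewrite -Ep in Ez.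
have Eq : 2 * (1 + 2 * z) =
    qform p%:Z (ctri p)%:Z (ctri p.-1)%:Z (utri p)%:Z :> int.
  apply/(@intr_inj rat); rewrite (rmorph_qform intr).
  have := sum_W_sqr p.-1; rewrite -Ep Ez mulrCA => /(mulfI nz_p) <-.
  by rewrite rmorphM.
set t : int := (24 + _ - _ - _).
rewrite Ez mulKf //.
(* The factor 2, invertible modulo p, makes [Eq] applicable. *)
have : (p%:Z %| 2 * (1 + 2 * z - t))%Z.
  rewrite -intr_Fp_eq0 // mulrBr Eq rmorphB (rmorph_qform intr) /= -!pmulrn.
  rewrite ctri_prime // ctri_pred_prime // utri_prime // pchar_Fp_0 //.
  have E0 := legendre_Fp p (-1) p_pr p_odd.
  have E1 := legendre_Fp p 3 p_pr p_odd.
  have E2 := expN3_half p p_pr p_odd.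
  have E3 : 3 ^+ p./2 = (-1) ^+ p./2 * (-3) ^+ p./2 :> 'F_p.
    by rewrite -exprMn mulrNN mul1r.
  have E4 : ((-1) ^+ p./2) ^+ 2 = 1 :> 'F_p.
    by rewrite -exprM mulnC exprM sqrrN !expr1n.
  rewrite /t !(rmorphB, rmorphD, rmorphM) /= E0 E1 -E2 [in X in _ - X]/= E3.
  rewrite /qform; apply/eqP.
  (* With e = (-1)^h and c = (-3)^h, the form at n = 0 is 48e^2 + 20e - 18c - 36ec, while 2t is 48 +
     20e - 18c - 36ec. *)
  transitivity (48 * (((-1) ^+ p./2) ^+ 2 - 1) : 'F_p); first by ring.
  by rewrite E4 subrr mulr0.
rewrite Gauss_dvdzr => [/dvdzP[q Eq']|]; last by rewrite coprimezE coprimen2.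
by exists q; rewrite -rmorphB Eq' rmorphM mulrC.
Qed.
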